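(* Let $\mathcal S=e_1,e_2,\ldots$ be a bipartite graph stream, let $M$ be the maximum reservoir size and $\gamma\in(0,1)$ the resampling parameter. For every $t\ge 1$, the estimate $Y^t$ returned by algorithm FLEET1 (with parameters $M,\gamma$) after processing the first $t$ edges satisfies $$\mathbb E[Y^t]=\xi^t,$$ where $\xi^t$ is the number of butterflies in the graph $G^t$ formed by the first $t$ edges.
   Context: Graphs are simple, undirected bipartite graphs with vertex set $L\sqcup R$ and edges in $L\times R$. A butterfly is a subgraph on $a\ne b\in L$, $x\neq y\in R$ with all four edges $(a,x),(a,y),(b,x),(b,y)$ present. A graph stream is a sequence $e_1,e_2,\ldots$ of distinct edges in arbitrary fixed order; $G^t$ is the graph with edge set $\{e_1,\ldots,e_t\}$ and $\xi^t$ is its number of butterflies. For an edge set $\mathcal R$, $\xi(\mathcal R)$ denotes the number of butterflies in the graph induced by $\mathcal R$. Algorithm FLEET1 with parameters $M$ (positive integer) and $\gamma\in(0,1)$: initialize $p\leftarrow 1$, reservoir $\mathcal R\leftarrow\emptyset$, $\beta\leftarrow 0$. On arrival of each edge $e=e_t$: (1) while $|\mathcal R|\ge M$: set $p\leftarrow\gamma p$; independently for each edge of $\mathcal R$, keep it in $\mathcal R$ with probability $\gamma$ and discard it with probability $1-\gamma$; set $\beta\leftarrow p^{-4}\,\xi(\mathcal R)$. (2) With probability $p$ (an independent coin), set $\mathcal R\leftarrow\mathcal R\cup\{e\}$ and $\beta\leftarrow\beta+p^{-4}\cdot b$, where $b$ is the number of butterflies containing $e$ in the graph induced by $\mathcal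 R$. (3) Set $Y^t\leftarrow\beta$. All random choices are mutually independent; expectation is over these choices only.
   Formalization: The formal theorem assumes the maximum reservoir size M is at least 5; for each M ≤ 4 the claim is false, e.g. for M = 4 a stream of the four edges of one butterfly followed by a disjoint edge gives Y^5 = 0 almost surely while ξ^5 = 1. *)

(* Defs.v *)
(* MathComp / MathComp-Analysis. *)
From mathcomp Require Import all_boot all_order all_algebra finmap.
From mathcomp Require Import all_classical all_reals all_analysis.

Set Implicit Arguments.
Unset Strict Implicit.
Unset Printing Implicit Defensive.

Import Order.TTheory GRing.Theory Num.Theory.

Local Open Scope classical_set_scope.
Local Open Scope fset_scope.
Local Open Scope ring_scope.

Section Graphs.
Variables VL VR : choiceType.

(* A bipartite graph is represented by its finite edge set in VL x VR.  A
   butterfly has no isolated vertex, so as a subgraph it is determined by its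
   edge set; the unordered choices of {a, b} and {x, y} are thus counted once. *)
Definition is_butterfly (B : {fset VL * VR}) : Prop :=
  exists a b x y, [/\ a != b, x != y &
    B = [fset (a, x); (a, y); (b, x); (b, y)]].

Definition butterflies (G : {fset VL * VR}) : {fset {fset VL * VR}} :=
  [fset B in fpowerset G | `[< is_butterfly B >]].

Definition num_butterflies (G : {fset VL * VR}) : nat := #|` butterflies G|.

Definition num_butterflies_at (G : {fset VL * VR}) (f : VL * VR) : nat :=
  #|` [fset B in butterflies G | f \in B]|.

(* Streams are indexed from 0: e 0 is the first edge to arrive. *)
Definition stream_graph (e : nat -> VL * VR) (t : nat) : {fset VL * VR} :=
  [fset e i | i in iota 0 t].

End Graphs.

Section Fleet1.
Variables (R : realType) (VL VR : choiceType).

Record fleet_state := FleetState {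
  sampling_prob : R;
  reservoir : {fset VL * VR};
  estimate : R }.

(* One random choice is attached to the insertion test of each arrival, and one
   to each (arrival, round of the while loop, edge of the reservoir). *)
Definition choice_index : choiceType := (nat + nat * nat * (VL * VR))%type.

Definition insert_choice (t : nat) : choice_index := inl t.
Definition keep_choice (t j : nat) (f : VL * VR) : choice_index :=
  inr (t, j, f).

(* A realisation u gives the values of uniform variables on [0, 1]; an event
   of probability q is decided by the test "u i < q". *)
Variables (M : nat) (gamma : R) (e : nat -> VL * VR) (u : choice_index -> R).

Definition fleet_init : fleet_state := FleetState 1 fset0 0.

Definition resample (t j : nat) (s : fleet_state) : fleet_state :=
  let p := gamma * sampling_prob s in
  let S := [fset f in reservoir s | u (keep_choice t j f) < gamma] in
  FleetState p S (p ^- 4 * (num_butterflies S)%:R).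

Fixpoint resample_rounds (t k : nat) (s : fleet_state) : fleet_state :=
  if k is j.+1 then resample t j (resample_rounds t j s) else s.

Definition loop_exit (t : nat) (s : fleet_state) (k : nat) : bool :=
  (#|` reservoir (resample_rounds t k s)| < M)%N.

(* If the loop never exits, which is a null event for the choices considered
   below, the state is arbitrarily left as it was. *)
Definition resample_loop (t : nat) (s : fleet_state) : fleet_state :=
  match pselect (exists k, loop_exit t s k) with
  | left h => resample_rounds t (ex_minn h) s
  | right _ => s
  end.

Definition insert (t : nat) (s : fleet_state) : fleet_state :=
  let p := sampling_prob s in
  if u (insert_choice t) < p then
    let S := e t |` reservoir s in
    FleetState p S
      (estimate s + p ^- 4 * (num_butterflies_at S (e t))%:R)
  else s.

(* State after the arrival of the first t edges e 0, ..., e t.-1. *)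
Fixpoint fleet1 (t : nat) : fleet_state :=
  if t is t'.+1 then insert t' (resample_loop t' (fleet1 t')) else fleet_init.

End Fleet1.

Section RandomChoices.
Context {d : measure_display} {T : measurableType d} {R : realType}.
Variables (P : probability T R) (I : choiceType) (U : I -> {RV P >-> R}).

Definition mutually_independent : Prop :=
  forall (J : {fset I}) (B : I -> set R), (forall i, measurable (B i)) ->
    P (\bigcap_(i in [set` J]) (U i @^-1` B i)) =
    (\prod_(i <- J) P (U i @^-1` B i))%E.

Definition standard_uniform : Prop :=
  forall (i : I) (A : set R), measurable A ->
    distribution P (U i) A = uniform_prob (@ltr01 R) A.

End RandomChoices.

(* The output of FLEET1 after t edges, when run with the random choices U. *)
Definition fleet1_estimate (d : measure_display) (T : measurableType d)
    (R : realType) (P : probability T R) (VL VR : choiceType)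
    (M : nat) (gamma : R) (e : nat -> VL * VR)
    (U : choice_index VL VR -> {RV P >-> R}) (t : nat) : T -> R :=
  fun w => estimate (fleet1 M gamma e (fun i => U i w) t).

(* Main.v *)
(* For a set B of edges let W_B = p^-|B| if B is contained in the reservoir and
   0 otherwise.  Since the edges of the stream are distinct, the estimate always
   equals the sum of the W_B over the butterflies B.  A round of resampling
   multiplies W_B by gamma^-|B| and by an independent indicator of probability
   gamma^|B|, and an insertion of an edge of B multiplies it by 1 / p and by an
   indicator of probability p; hence W_B has mean 1 for every set B of arrived
   edges, as long as each loop is stopped after at most n rounds.
   The difference with the actual algorithm lives on the event that some loop is
   still running after n rounds.  There the reservoir has at least M > 4 edges,
   so for |B| <= 4 it contains some edge f outside B, and
   W_B <= gamma^n W_(B + f), whose mean is gamma^n.  Letting n go to infinity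
   gives the claim. *)
Require Import Defs.
From mathcomp Require Import all_boot all_order all_algebra finmap.
From mathcomp Require Import all_classical all_reals all_analysis.
From mathcomp Require Import measurable_realfun.

Set Implicit Arguments.
Unset Strict Implicit.
Unset Printing Implicit Defensive.

Import Order.TTheory GRing.Theory Num.Theory.

Local Open Scope ring_scope.
Local Open Scope classical_set_scope.

(** * Integration lemmas *)

Section Integrals.
Import HBNNSimple.
Context {d : measure_display} {T : measurableType d} {R : realType}.
Variable mu : {measure set T -> \bar R}.

Lemma integral_mul_indic (D A : set T) (f : T -> R) :
  (\int[mu]_(w in D) (f w * \1_A w)%:E = \int[mu]_(w in D `&` A) (f w)%:E)%E.
Proof.
rewrite integral_mkcondr; apply: eq_integral => w _.
by rewrite patchE indicE; case: (w \in A); rewrite ?mulr1 ?mulr0.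
Qed.

(* [g] need not be measurable outside [A], so the upper bound goes through the
   simple functions below [g]. *)
Lemma ge0_integral_conull (A : set T) (g : T -> \bar R) :
  measurable A -> mu (~` A) = 0%E -> measurable_fun A g ->
  (forall w, 0 <= g w)%E -> (\int[mu]_w g w = \int[mu]_(w in A) g w)%E.
Proof.
move=> mA A0 mg g0; apply/eqP; rewrite eq_le; apply/andP; split.
  rewrite ge0_integralTE//; apply: ge_ereal_sup => _ [h /= hg <-].
  have mh : measurable_fun setT (EFin \o h) by exact/measurable_EFinP.
  rewrite -integralT_nnsfun -(setUv A) ge0_integral_setU//=.
  - rewrite (@null_set_integral _ _ _ _ (~` A))//; last 2 first.
      exact: measurableC.
      by apply: measurable_funTS; exact: mh.
    rewrite adde0; apply: ge0_le_integral => //.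
    + by move=> w _; rewrite lee_fin.
    + by apply: measurable_funTS; exact: mh.
  - exact: measurableC.
  - by rewrite setUv; exact: mh.
  - by move=> w _; rewrite lee_fin.
  - by apply/disj_set2P; rewrite setICr.
(* Conversely, a simple function below the restriction of [g] to [A] is below [g], as [g] is
   nonnegative. *)
rewrite integral_mkcond !ge0_integralTE//; last first.
  by move=> w; apply: erestrict_ge0.
apply: ge_ereal_sup => _ [h /= hg <-]; apply: ereal_sup_ubound; exists h => // w.
apply: le_trans (hg w) _; rewrite patchE; case: ifP => // _; exact: g0.
Qed.

Lemma integral_addr (D : set T) (f g : T -> R) : measurable D ->
  measurable_fun setT f -> (forall w, 0 <= f w) ->
  measurable_fun setT g -> (forall w, 0 <= g w) ->
  (\int[mu]_(w in D) (f w + g w)%:E =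
   \int[mu]_(w in D) (f w)%:E + \int[mu]_(w in D) (g w)%:E)%E.
Proof.
move=> mD mf f0 mg g0; under eq_integral do rewrite EFinD.
rewrite ge0_integralD//.
- by move=> w _; rewrite lee_fin.
- by apply: measurable_funTS; exact/measurable_EFinP.
- by move=> w _; rewrite lee_fin.
- by apply: measurable_funTS; exact/measurable_EFinP.
Qed.

End Integrals.

(** * Probability that a uniform choice falls below a threshold *)

Section UniformBelow.
Variable R : realType.

Lemma uniform_prob_itvNyo (q : R) : 0 <= q <= 1 ->
  uniform_prob (@ltr01 R) `]-oo, q[ = q%:E.
Proof.
move=> /andP[q0 q1]; rewrite /uniform_prob integral_uniform_pdf.
have -> : `]-oo, q[ `&` `[0%R, 1%R] = `[0%R, q[%classic :> set R.
  apply/seteqP; split => x /=; rewrite !in_itv/=.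
    by case=> xq /andP[-> _].
  by move=> /andP[x0 xq]; split => //; rewrite x0/= ltW// (lt_le_trans xq).
rewrite (eq_integral (cst 1%E)); last first.
  move=> x; rewrite inE/= in_itv/= => /andP[x0 xq].
  by rewrite /uniform_pdf x0/= ltW ?(lt_le_trans xq)// subr0 invr1.
rewrite integral_cst//= mul1e lebesgue_measure_itv/= lte_fin.
(* The interval is empty only when [q <= 0], and then [q = 0]. *)
by case: ltP => [_|q0']; rewrite ?sube0// (@le_anti _ _ q 0) ?q0 ?q0'.
Qed.

End UniformBelow.

(** * Independence from the choices outside an index set *)

Section IndepOff.
Context {d : measure_display} {T : measurableType d} {R : realType}.
Variables (P : probability T R) (I : choiceType) (U : I -> {RV P >-> R}).

Definition box (F : {fset I}) (B : I -> set R) : set T :=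
  \bigcap_(i in [set` F]) (U i @^-1` B i).

Lemma measurable_box F B : (forall i, measurable (B i)) -> measurable (box F B).
Proof.
move=> mB; apply: fin_bigcap_measurable; first exact: finite_fset.
by move=> i _; apply: measurable_funPTI.
Qed.

Lemma box_insert (F : {fset I}) (B : I -> set R) (i : I) (C : set R) :
  i \notin F ->
  box F B `&` U i @^-1` C =
  box (i |` F)%fset (fun j => if j == i then C else B j).
Proof.
move=> iF; apply/seteqP; split => w /=.
  move=> [wF wC] j /=; rewrite !inE => /orP[/eqP->|jF]; first by rewrite eqxx.
  by case: eqP => [->//|_]; exact: wF.
move=> h; split; last by have := h i; rewrite /= eqxx; apply; rewrite !inE eqxx.
move=> j /= jF; have := h j; rewrite /= !inE jF orbT => /(_ isT).
by case: eqP => // ji; rewrite -ji jF in iF.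
Qed.

(* [f] has the independence from the choices outside [J] that a function of
   the choices in [J] has. *)
Definition indep_off (J : set I) (f : T -> R) :=
  [/\ measurable_fun setT f, (forall w, 0 <= f w) &
    forall (F : {fset I}) (B : I -> set R),
      (forall i, i \in F -> ~ J i) -> (forall i, measurable (B i)) ->
      (\int[P]_(w in box F B) (f w)%:E =
       \int[P]_w (f w)%:E * P (box F B))%E].

Lemma indep_offS (J J' : set I) f : J `<=` J' -> indep_off J f -> indep_off J' f.
Proof.
move=> JJ' [mf f0 hf]; split=> // F B FJ mB; apply: hf => // i /FJ nJ' /JJ'.
by [].
Qed.

Lemma indep_off_cst (J : set I) (c : R) : 0 <= c -> indep_off J (cst c).
Proof.
move=> c0; split => // F B FJ mB.
rewrite (integral_cst P (measurable_box _ mB) c%:E).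
rewrite (integral_cst P measurableT c%:E).
rewrite [X in (_ * X * _)%E](_ : _ = 1%E) ?mule1//; exact: probability_setT.
Qed.

Lemma indep_offD (J : set I) f g : indep_off J f -> indep_off J g ->
  indep_off J (fun w => f w + g w).
Proof.
move=> [mf f0 hf] [mg g0 hg]; split.
- exact: measurable_funD.
- by move=> w; rewrite addr_ge0.
- move=> F B FJ mB.
  rewrite !integral_addr//; last exact: measurable_box.
  rewrite hf// hg// [RHS]ge0_muleDl//; by apply: integral_ge0 => w _; rewrite lee_fin.
Qed.

Lemma indep_off_integralD (J J' : set I) f g : indep_off J f -> indep_off J' g ->
  (\int[P]_w (f w + g w)%:E = \int[P]_w (f w)%:E + \int[P]_w (g w)%:E)%E.
Proof. by move=> [mf f0 _] [mg g0 _]; exact: integral_addr. Qed.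

Lemma indep_off_sum (J : set I) (K : Type) (s : seq K) (f : K -> T -> R) :
  (forall k, indep_off J (f k)) -> indep_off J (fun w => \sum_(k <- s) f k w).
Proof.
move=> hf; elim: s => [|k s IH].
  by under eq_fun do rewrite big_nil; exact: indep_off_cst.
by under eq_fun do rewrite big_cons; exact: indep_offD.
Qed.

Hypothesis hindep : mutually_independent U.

Lemma prob_box (F : {fset I}) (B : I -> set R) : (forall i, measurable (B i)) ->
  (P (box F B) = \prod_(i <- F) P (U i @^-1` B i))%E.
Proof. exact: hindep. Qed.

Lemma prob_box_insert (F : {fset I}) (B : I -> set R) (i : I) (C : set R) :
  i \notin F -> (forall j, measurable (B j)) -> measurable C ->
  (P (box F B `&` U i @^-1` C) = P (U i @^-1` C) * P (box F B))%E.
Proof.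
move=> iF mB mC; rewrite box_insert// !prob_box//; last first.
  by move=> j; case: eqP.
rewrite big_fsetU1//= eqxx; congr (_ * _)%E.
rewrite big_seq [RHS]big_seq; apply: eq_bigr => j jF.
by case: eqP => // ji; rewrite -ji jF in iF.
Qed.

Lemma indep_off_integral1 (J : set I) f i (C : set R) :
  ~ J i -> measurable C -> indep_off J f ->
  (\int[P]_w (f w * \1_(U i @^-1` C) w)%:E =
   \int[P]_w (f w)%:E * P (U i @^-1` C))%E.
Proof.
move=> nJi mC [mf f0 hf]; rewrite integral_mul_indic.
have -> : setT `&` U i @^-1` C = box [fset i]%fset (fun=> C).
  apply/seteqP; split => w /=; first by move=> [_ wC] j /=; rewrite inE => /eqP->.
  by move=> h; split => //; apply: h; rewrite /= inE.
rewrite hf//; last by move=> j; rewrite inE => /eqP->.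
by rewrite prob_box// big_seq_fset1.
Qed.

(** A box off the enlarged index set, further constrained at [i], is a box off [J]. The independence
    of [f] applies to it, and mutual independence then splits off the factor of [i]. *)
Lemma indep_off_test (J : set I) f i (C : set R) :
  ~ J i -> measurable C -> indep_off J f ->
  indep_off (J `|` [set i]) (fun w => f w * \1_(U i @^-1` C) w).
Proof.
move=> nJi mC ff; have [mf f0 hf] := ff.
have mUC : measurable (U i @^-1` C) by exact: measurable_funPTI.
split.
- by apply: measurable_funM => //; exact: measurable_indic.
- by move=> w; rewrite mulr_ge0.
- move=> F B FJ mB.
  have iF : i \notin F by apply/negP => /FJ; apply; right.
  rewrite (indep_off_integral1 nJi)// integral_mul_indic box_insert// hf//.
  + by rewrite -box_insert// prob_box_insert// muleA.
  + by move=> j; rewrite !inE => /orP[/eqP->//|/FJ jJ Jj]; apply: jJ; left.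
  + by move=> j; case: eqP.
Qed.

(* Quantifying over all nonnegative [phi] makes this stable under
   post-composition of [X] with an arbitrary function. *)
Definition adapted (J : set I) (S : Type) (X : T -> S) :=
  forall phi : S -> R, (forall s, 0 <= phi s) -> indep_off J (fun w => phi (X w)).

Lemma adaptedS (J J' : set I) S (X : T -> S) :
  J `<=` J' -> adapted J X -> adapted J' X.
Proof. by move=> JJ' aX phi phi0; apply: indep_offS JJ' _; exact: aX. Qed.

Lemma adapted_cst (J : set I) S (s : S) : adapted J (fun=> s).
Proof. by move=> phi phi0; exact: indep_off_cst. Qed.

Lemma adapted_comp (J : set I) S S' (X : T -> S) (g : S -> S') :
  adapted J X -> adapted J (fun w => g (X w)).
Proof. by move=> aX phi phi0; apply: (aX (phi \o g)) => s; apply: phi0. Qed.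

(** The threshold is random, but where [theta (X w) = q] the test is a fixed event about the choice
    [i]. Having finitely many values in [Q] turns this case distinction into a finite sum. *)
Lemma adapted_test (J : set I) S (X : T -> S) (theta : S -> R) (Q : seq R) i :
  ~ J i -> (forall w, theta (X w) \in Q) -> adapted J X ->
  adapted (J `|` [set i]) (fun w => (X w, U i w < theta (X w))).
Proof.
move=> nJi hQ aX phi phi0.
pose f q b s := (theta s == q)%:R * phi (s, b).
have f0 q b s : 0 <= f q b s by rewrite mulr_ge0.
have -> : (fun w => phi (X w, U i w < theta (X w))) = fun w =>
    \sum_(q <- undup Q) (f q true (X w) * \1_(U i @^-1` `]-oo, q[) w +
                         f q false (X w) * \1_(U i @^-1` `[q, +oo[) w).
  apply/funext => w; rewrite (bigD1_seq (theta (X w))) ?undup_uniq ?mem_undup//=.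
  rewrite big1 ?addr0 => [|q /negbTE qX]; last first.
    by rewrite /f eq_sym qX !mul0r addr0.
  rewrite /f eqxx !mul1r !indicE.
  have -> : (w \in U i @^-1` `]-oo, theta (X w)[) = (U i w < theta (X w)).
    by apply/idP/idP; rewrite inE/= in_itv.
  have -> : (w \in U i @^-1` `[theta (X w), +oo[) = ~~ (U i w < theta (X w)).
    by apply/idP/idP; rewrite inE/= in_itv/= andbT leNgt.
  by case: (_ < _); rewrite /= ?(mulr1, mulr0, addr0, add0r).
apply: indep_off_sum => q; apply: indep_offD;
  by apply: indep_off_test => //; apply: (aX (f q _)) => s; exact: f0.
Qed.

End IndepOff.

(** * Counting butterflies *)

Section Butterflies.
Variables VL VR : choiceType.
Implicit Types (G S B : {fset VL * VR}) (f : VL * VR).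

Lemma in_butterflies G B :
  (B \in butterflies G) = (B `<=` G)%fset && `[< is_butterfly B >].
Proof. by rewrite !inE/= fpowersetE. Qed.

Lemma card_butterfly B : is_butterfly B -> #|` B|%fset = 4%N.
Proof.
move=> [a [b [x [y [ab xy ->]]]]].
rewrite -!fsetUA !cardfsU1 cardfs1 !inE !xpair_eqE !eqxx/=.
by rewrite (negbTE ab) (negbTE xy).
Qed.

(** For a random reservoir [S], summing over the butterflies of a fixed graph [G] allows the mean to
    be taken term by term. *)
Lemma num_butterfliesE G S : (S `<=` G)%fset ->
  num_butterflies S = (\sum_(B <- butterflies G) (B `<=` S)%fset)%N.
Proof.
move=> SG; rewrite /num_butterflies card_fset_sum1.
rewrite big_seq (eq_bigr (fun B => nat_of_bool (B `<=` S)%fset)) -?big_seq.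
  apply: big_fset_incl => [|B].
    by apply/fsubsetP => B; rewrite !in_butterflies => /andP[BS ->];
      rewrite (fsubset_trans BS).
  by rewrite !in_butterflies => /andP[_ ->]; rewrite andbT => /negbTE ->.
by move=> B; rewrite in_butterflies => /andP[->].
Qed.

(** The butterflies of the enlarged graph that avoid [f] are exactly those of [S]. *)
Lemma num_butterfliesU1 S f : f \notin S ->
  num_butterflies (f |` S)%fset =
  (num_butterflies S + num_butterflies_at (f |` S)%fset f)%N.
Proof.
move=> fS; rewrite /num_butterflies /num_butterflies_at.
rewrite -(cardfsID [fset B in butterflies (f |` S) | f \notin B]%fset
  (butterflies (f |` S)%fset)).
congr (_ + _)%N; congr (#|` _|%fset); apply/fsetP => B; rewrite !inE/= !fpowersetE.
  rewrite andbA andbb -andbA [_ && (f \notin B)]andbC andbA; congr (_ && _).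
  apply/andP/idP => [[BfS fB]|BS].
    apply/fsubsetP => g gB; have := fsubsetP BfS g gB.
    by rewrite !inE => /orP[/eqP gf|//]; rewrite -gf gB in fB.
  split; first exact: fsubset_trans BS (fsubsetU1 _ _).
  by apply: contra fS; exact: (fsubsetP BS).
by case: (f \in B); rewrite /= ?andbF ?andbT ?andNb.
Qed.

End Butterflies.

(** * The graph of the arrived edges *)

Lemma in_stream_graph (VL VR : choiceType) (e : nat -> VL * VR) t f :
  reflect (exists2 i, (i < t)%N & f = e i) (f \in stream_graph e t).
Proof.
rewrite /stream_graph; apply: (iffP (imfsetP _ _ _ _)) => /= -[i].
  by rewrite mem_iota => it ->; exists i.
by move=> it ->; exists i; rewrite // mem_iota.
Qed.

Lemma stream_graphS (VL VR : choiceType) (e : nat -> VL * VR) t :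
  stream_graph e t.+1 = (e t |` stream_graph e t)%fset.
Proof.
apply/fsetP => f; rewrite !inE; apply/in_stream_graph/orP.
  move=> [i]; rewrite ltnS leq_eqVlt => /orP[/eqP -> ->|it ->]; first by left.
  by right; apply/in_stream_graph; exists i.
move=> [/eqP ->|/in_stream_graph[i it ->]]; first by exists t.
by exists i => //; exact: ltnW.
Qed.

Lemma card_stream_graph (VL VR : choiceType) (e : nat -> VL * VR) t :
  (#|` stream_graph e t|%fset <= t)%N.
Proof.
elim: t => [|t IH].
  rewrite leqn0 cardfs_eq0; apply/eqP/fsetP => f; rewrite inE.
  by apply/in_stream_graph => -[].
by rewrite stream_graphS cardfsU1 -add1n leq_add ?leq_b1.
Qed.

(** * The capped algorithm and its pathwise comparison with FLEET1 *)

Section Capped.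
Variables (R : realType) (VL VR : choiceType) (M : nat) (gamma : R).
Variables (e : nat -> VL * VR) (u : choice_index VL VR -> R).
Implicit Types (s : fleet_state R VL VR) (t n k j : nat).

(* The algorithm with at most [n] rounds of resampling per arrival, together
   with a flag telling whether every loop so far would have stopped within its
   [n] rounds. *)
Fixpoint capped_rounds t n s : fleet_state R VL VR :=
  if n is j.+1 then
    let s' := capped_rounds t j s in
    if (#|` reservoir s'|%fset < M)%N then s' else resample gamma u t j s'
  else s.

Fixpoint capped n t : fleet_state R VL VR * bool :=
  if t is t'.+1 then
    let s := capped_rounds t' n (capped n t').1 in
    (insert e u t' s, (capped n t').2 && (#|` reservoir s|%fset < M)%N)
  else (fleet_init R VL VR, true).

Lemma resample_subset t j s :
  (reservoir (resample gamma u t j s) `<=` reservoir s)%fset.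
Proof. by apply/fsubsetP => f; rewrite !inE/= => /andP[]. Qed.

Lemma capped_rounds_subset t n s :
  (reservoir (capped_rounds t n s) `<=` reservoir s)%fset.
Proof.
elim: n => //= n IH; case: ifP => // _.
exact: fsubset_trans (resample_subset _ _ _) IH.
Qed.

Lemma resample_rounds_subset t n s :
  (reservoir (resample_rounds gamma u t n s) `<=` reservoir s)%fset.
Proof.
elim: n => //= n IH; exact: fsubset_trans (resample_subset _ _ _) IH.
Qed.

Lemma resample_loop_subset t s :
  (reservoir (resample_loop M gamma u t s) `<=` reservoir s)%fset.
Proof.
rewrite /resample_loop; case: pselect => // h; exact: resample_rounds_subset.
Qed.

Lemma insert_subset t s :
  (reservoir (insert e u t s) `<=` e t |` reservoir s)%fset.
Proof. by rewrite /insert; case: ifP => //= _; exact: fsubsetU1. Qed.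

Lemma capped_subset n t : (reservoir (capped n t).1 `<=` stream_graph e t)%fset.
Proof.
elim: t => [|t IH] /=; first exact: fsub0set.
rewrite stream_graphS; apply: fsubset_trans (insert_subset _ _) _.
by apply: fsetUS; apply: fsubset_trans (capped_rounds_subset _ _ _) IH.
Qed.

Lemma fleet1_subset t :
  (reservoir (fleet1 M gamma e u t) `<=` stream_graph e t)%fset.
Proof.
elim: t => [|t IH] /=; first exact: fsub0set.
rewrite stream_graphS; apply: fsubset_trans (insert_subset _ _) _.
by apply: fsetUS; apply: fsubset_trans (resample_loop_subset _ _) IH.
Qed.

Lemma sampling_prob_insert t s : sampling_prob (insert e u t s) = sampling_prob s.
Proof. by rewrite /insert; case: ifP. Qed.

Lemma capped_rounds_prob t n s : exists2 k, (k <= n)%N &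
  sampling_prob (capped_rounds t n s) = gamma ^+ k * sampling_prob s.
Proof.
elim: n => [|n [k kn IH]] /=; first by exists 0%N; rewrite // expr0 mul1r.
case: ifP => _; first by exists k => //; exact: leqW.
by exists k.+1 => //=; rewrite IH exprS mulrA.
Qed.

(** The bound on the exponent confines the sampling probability to finitely many values, as
    [adapted_test] requires. *)
Lemma capped_prob n t : exists2 k, (k <= n * t)%N &
  sampling_prob (capped n t).1 = gamma ^+ k.
Proof.
elim: t => [|t [k kt IH]] /=; first by exists 0%N.
have [l ln E] := capped_rounds_prob t n (capped n t).1.
exists (l + k)%N; first by rewrite mulnS leq_add.
by rewrite sampling_prob_insert E IH exprD.
Qed.

(** Below [M] edges the capped loop no longer changes its state, so a reservoir still full after [n]
    rounds has undergone all of them. *)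
Lemma capped_rounds_running t n s :
  (M <= #|` reservoir (capped_rounds t n s)|%fset)%N ->
  [/\ capped_rounds t n s = resample_rounds gamma u t n s,
      sampling_prob (capped_rounds t n s) = gamma ^+ n * sampling_prob s &
      forall j, (j <= n)%N -> ~~ loop_exit M gamma u t s j].
Proof.
elim: n => [Ms|n IH] /=.
  split; rewrite ?expr0 ?mul1r// => j; rewrite leqn0 => /eqP ->.
  by rewrite /loop_exit -leqNgt.
case: ltnP => [sM|Ms Ms']; first by rewrite leqNgt sM.
have [E1 E2 nex] := IH Ms; rewrite -E1; split=> //=.
  by rewrite E2 exprS mulrA.
move=> j; rewrite leq_eqVlt => /orP[/eqP ->|]; last exact: nex.
by rewrite /loop_exit /= -E1 -leqNgt.
Qed.

(** The number of rounds actually performed is the least exit index, which is also what [ex_minn]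
    selects. *)
Lemma capped_rounds_stopped t n s :
  (#|` reservoir (capped_rounds t n s)|%fset < M)%N ->
  capped_rounds t n s = resample_loop M gamma u t s /\
  capped_rounds t n.+1 s = capped_rounds t n s.
Proof.
move=> h; split; last by rewrite /= h.
have [k [Ek exk mink]] : exists k, [/\
    capped_rounds t n s = resample_rounds gamma u t k s,
    loop_exit M gamma u t s k &
    forall j, loop_exit M gamma u t s j -> (k <= j)%N].
  elim: n h => [|n IH] /=; first by move=> h; exists 0%N; split.
  have [sM|Ms h] := ltnP (#|` reservoir (capped_rounds t n s)|)%fset M.
    by rewrite sM => _; exact: IH.
  have [E _ nex] := capped_rounds_running Ms.
  exists n.+1; split; rewrite /= -?E// ?/loop_exit/= -?E//.
  by move=> j exj; rewrite ltnNge; apply/negP => /nex/negP; apply.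
rewrite /resample_loop; case: pselect => [ex|nex]; last by case: nex; exists k.
case: ex_minnP => m exm minm; rewrite Ek; congr resample_rounds.
by apply/eqP; rewrite eqn_leq mink// minm.
Qed.

Lemma capped_fleet1 n t : (capped n t).2 ->
  (capped n t).1 = fleet1 M gamma e u t.
Proof.
elim: t => //= t IH /andP[/IH <- /capped_rounds_stopped[-> _]] //.
Qed.

(** Raising the cap does not affect a run whose loops have all stopped; the events without a cut
    loop thus increase with [n]. *)
Lemma cappedS n t : (capped n t).2 -> capped n.+1 t = capped n t.
Proof.
elim: t => //= t IH /andP[gt]; rewrite (IH gt) => h.
by have [_ /= ->] := capped_rounds_stopped h; rewrite gt h.
Qed.

(** A resampling recomputes the estimate from the reservoir, and an insertion adds exactly the
    butterflies through the new edge, which is not yet in the reservoir because the edges are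
    distinct. *)
Lemma estimate_fleet1 N t : (t <= N)%N ->
  (forall i j : nat, (i < N)%N -> (j < N)%N -> e i = e j -> i = j) ->
  let s := fleet1 M gamma e u t in
  estimate s = sampling_prob s ^- 4 * (num_butterflies (reservoir s))%:R.
Proof.
move=> tN inj_e; elim: t tN => [_|t IH tN] /=.
  rewrite (_ : num_butterflies _ = 0%N) ?mulr0//.
  apply/eqP; rewrite cardfs_eq0; apply/eqP/fsetP => B; rewrite in_butterflies inE.
  apply/negbTE/negP => /andP[B0 /asboolP /card_butterfly].
  by move: B0; rewrite fsubset0 => /eqP ->; rewrite cardfs0.
set s := fleet1 _ _ _ _ t in IH *.
have etN : e t \notin reservoir (resample_loop M gamma u t s).
  apply/negP => /(fsubsetP (fsubset_trans (resample_loop_subset _ _) (fleet1_subset t))).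
  move=> /in_stream_graph[i it] /(inj_e _ _ tN (ltn_trans it tN)) ti.
  by rewrite ti ltnn in it.
have Es : let s' := resample_loop M gamma u t s in
    estimate s' = sampling_prob s' ^- 4 * (num_butterflies (reservoir s'))%:R.
  (* If the loop performs no round, or never exits, the state is unchanged; otherwise its last round
     has just recomputed the estimate. *)
  rewrite /resample_loop; case: pselect => [ex|_]; last exact/IH/ltnW.
  by case: (ex_minn ex) => [|k]//=; exact/IH/ltnW.
rewrite /insert; case: ifP => _ //=.
by rewrite num_butterfliesU1// natrD mulrDr Es.
Qed.

End Capped.

(** * Effect of each operation on the weight of an edge set *)

Section Weight.
Variables (R : realType) (VL VR : choiceType) (gamma : R).
Variables (e : nat -> VL * VR) (u : choice_index VL VR -> R).
Implicit Types (s : fleet_state R VL VR) (B : {fset VL * VR}).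

(* The exponent is #|B| rather than 4, so that the weight has mean 1 for every
   set of arrived edges; the estimate sums the weights of the butterflies. *)
Definition weight B s : R :=
  sampling_prob s ^- #|` B|%fset * (B `<=` reservoir s)%fset%:R.

Lemma weight_ge0 B s : 0 < sampling_prob s -> 0 <= weight B s.
Proof. by move=> p0; rewrite mulr_ge0// invr_ge0 exprn_ge0// ltW. Qed.

Lemma weight_resample B t j s :
  weight B (resample gamma u t j s) = gamma ^- #|` B|%fset *
    (weight B s * [forall f : B, u (keep_choice t j (val f)) < gamma]%:R).
Proof.
rewrite /weight /= exprMn invfM -!mulrA; congr (_ * (_ * _)).
rewrite -natrM mulnb; congr (nat_of_bool _)%:R; apply/fsubsetP/andP => [h|[BS hB] f fB].
  split; first by apply/fsubsetP => f /h; rewrite !inE/= => /andP[].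
  by apply/forallP => f; have := h _ (fsvalP f); rewrite !inE/= => /andP[].
rewrite !inE/= (fsubsetP BS)//=; exact: (forallP hB [` fB]%fset).
Qed.

Lemma weight_insert_notin B t s : e t \notin B ->
  weight B (insert e u t s) = weight B s.
Proof.
move=> etB; rewrite /insert; case: ifP => // _; rewrite /weight/=.
congr (_ * _%:R); congr nat_of_bool; apply/idP/idP => [BS|BS].
  apply/fsubsetP => f fB; have := fsubsetP BS _ fB.
  by rewrite !inE => /orP[/eqP fe|//]; rewrite -fe fB in etB.
exact: fsubset_trans BS (fsubsetU1 _ _).
Qed.

(** As [e t] is new to the reservoir, the enlarged set can lie inside only after a successful
    insertion; the extra edge accounts for the factor 1 / p. *)
Lemma weight_insert_in B t s : e t \notin B -> e t \notin reservoir s ->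
  weight (e t |` B)%fset (insert e u t s) =
  (sampling_prob s)^-1 * weight B s * (u (insert_choice VL VR t) < sampling_prob s)%R%:R.
Proof.
move=> etB etS; rewrite /insert; case: ifP => _; rewrite /weight/= cardfsU1 etB.
  rewrite add1n exprS invfM mulr1 -!mulrA; congr (_ * (_ * (nat_of_bool _)%:R)).
  rewrite fsubUset fsub1set !inE eqxx/=; apply/idP/idP => [BS|BS].
    apply/fsubsetP => f fB; have := fsubsetP BS _ fB.
    by rewrite !inE => /orP[/eqP fe|//]; rewrite -fe fB in etB.
  exact: fsubset_trans BS (fsubsetU1 _ _).
by rewrite fsubUset fsub1set (negbTE etS) !mulr0.
Qed.

End Weight.

(** * Expected weights in the capped algorithm *)

Section ExpectedWeight.
Context {d : measure_display} {T : measurableType d} {R : realType}.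
Variables (P : probability T R) (VL VR : choiceType).
Variables (e : nat -> VL * VR) (M : nat) (gamma : R).
Variable U : choice_index VL VR -> {RV P >-> R}.
Hypotheses (gamma0 : 0 < gamma) (gamma1 : gamma < 1).
Hypotheses (hindep : mutually_independent U) (hunif : standard_uniform U).

Let u (w : T) : choice_index VL VR -> R := fun i => U i w.

(** [adapted] only covers functions nonnegative on all states, while [weight] is known to be so
    where the sampling probability is positive. Taking the absolute value of [phi] changes nothing
    along [X]. *)
Lemma adapted_ge0 J S (X : T -> S) phi : adapted U J X ->
  (forall w, 0 <= phi (X w)) -> indep_off U J (fun w => phi (X w)).
Proof.
move=> aX phi0; have -> : (fun w => phi (X w)) = (fun w => `|phi (X w)|).
  by apply/funext => w; rewrite ger0_norm.
exact: (aX (fun s => `|phi s|)).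
Qed.

Lemma prob_below i (q : R) : 0 <= q <= 1 -> P (U i @^-1` `]-oo, q[) = q%:E.
Proof. by move=> q01; rewrite -(uniform_prob_itvNyo q01) -(hunif i). Qed.

(** The choice [i] is fresh with respect to [X], so the test succeeds with conditional probability
    [theta (X w)]; the values in [Q] are treated one by one. *)
Lemma integral_test J S (X : T -> S) (g theta : S -> R) (Q : seq R) i :
  ~ J i -> adapted U J X -> (forall w, 0 <= g (X w)) ->
  (forall w, theta (X w) \in Q) -> (forall q, q \in Q -> 0 <= q <= 1) ->
  (\int[P]_w (g (X w) * (U i w < theta (X w))%R%:R)%:E =
   \int[P]_w (g (X w) * theta (X w))%:E)%E.
Proof.
move=> nJi aX g0 hQ Q01.
(* The condition [q \in Q] makes [f q (X w) * q] nonnegative for every real [q], as the exchange of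
   sum and integral below asks. *)
pose f q s := ((theta s == q) && (q \in Q))%:R * g s.
have f0 q w : 0 <= f q (X w) by rewrite mulr_ge0.
have ff q : indep_off U J (fun w => f q (X w)) by exact: (adapted_ge0 aX (f0 q)).
have fE w (h : R -> R) : g (X w) * h (theta (X w)) =
    \sum_(q <- undup Q) f q (X w) * h q.
  rewrite (bigD1_seq (theta (X w))) ?undup_uniq ?mem_undup//=.
  rewrite /f eqxx hQ mul1r big1 ?addr0// => q /negbTE qX.
  by rewrite eq_sym qX !mul0r.
have fq0 q w : 0 <= f q (X w) * q.
  by rewrite /f; have [/Q01/andP[q0 _]|_] := boolP (q \in Q);
    rewrite ?andbF ?mul0r// mulr_ge0// mulr_ge0.
have mf q : measurable_fun setT (fun w => f q (X w)) by case: (ff q).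
under eq_integral do rewrite (fE _ (fun q => (U i _ < q)%R%:R)) -sumEFin.
under [RHS]eq_integral do rewrite (fE _ id) -sumEFin.
have below q w : (U i w < q)%R%:R = \1_(U i @^-1` `]-oo, q[) w :> R.
  rewrite indicE; congr (nat_of_bool _)%:R.
  by apply/idP/idP; rewrite inE/= in_itv.
rewrite !ge0_integral_sum//.
- rewrite big_seq [RHS]big_seq; apply: eq_bigr => q; rewrite mem_undup => /Q01 q01.
  under eq_integral do rewrite below.
  rewrite (indep_off_integral1 hindep nJi)// prob_below//.
  under [RHS]eq_integral do rewrite EFinM muleC.
  rewrite ge0_integralZl_EFin//.
  + by rewrite muleC.
  + by move=> w _; rewrite lee_fin.
  + exact/measurable_EFinP.
  + by case/andP: q01.
- by move=> q; apply/measurable_EFinP/measurable_funM.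
- by move=> q w _; rewrite lee_fin.
- move=> q; apply/measurable_EFinP; under eq_fun do rewrite below.
  apply: measurable_funM => //; apply: measurable_indic; exact: measurable_funPTI.
- by move=> q w _; rewrite lee_fin mulr_ge0.
Qed.

(** The choices made before round [j] of the loop of arrival [t]. The insertion choice of [t] is
    drawn after that loop, so it first appears in [past t.+1 0]. *)
Definition past t j : set (choice_index VL VR) := fun i =>
  match i with
  | inl s => (s < t)%N
  | inr (s, k, _) => (s < t)%N || (s == t) && (k < j)%N
  end.

Lemma past_insert t j : past t j `|` [set insert_choice VL VR t] `<=` past t.+1 0.
Proof.
move=> [s|[[s k] f]] /=; first by case=> [/ltnW//|[->]].
by case=> // /orP[/ltnW st|/andP[/eqP -> _]]; rewrite ltnS ?st ?leqnn.
Qed.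

Lemma past_keep t j (A : set (VL * VR)) :
  past t j `|` keep_choice t j @` A `<=` past t j.+1.
Proof.
move=> [s|[[s k] f]] /=; first by case=> // -[].
case=> [/orP[->//|/andP[-> kj]]|[g _ [-> ->]] ]; first by rewrite (leqW kj) orbT.
by rewrite eqxx ltnSn orbT.
Qed.

Lemma insert_fresh t j : ~ past t j (insert_choice VL VR t).
Proof. by rewrite /past/= ltnn. Qed.

Lemma keep_fresh t j f : ~ past t j (keep_choice t j f).
Proof. by rewrite /past/= eqxx !ltnn. Qed.

(** The edges are tested one at a time along a fixed list, since the index set in [adapted] cannot
    be random. *)
Lemma adapted_filter J S (X : T -> S) t j (L : seq (VL * VR)) : uniq L ->
  (forall f, ~ J (keep_choice t j f)) -> adapted U J X ->
  adapted U (J `|` keep_choice t j @` [set` L])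
    (fun w => (X w, [seq f <- L | U (keep_choice t j f) w < gamma])).
Proof.
move=> + nJ aX; elim: L => [_|f L IH /= /andP[fL /IH aL]].
  apply: (adaptedS (J := J)); first by move=> i; left.
  exact: (adapted_comp (fun s => (s, [::]))).
have nf : ~ (J `|` keep_choice t j @` [set` L]) (keep_choice t j f).
  by case=> [/nJ//|[g /= gL [gf]]]; rewrite -gf gL in fL.
have hQ w : (fun=> gamma) (X w, [seq f <- L | U (keep_choice t j f) w < gamma])
    \in [:: gamma] by rewrite inE.
have := adapted_test hindep nf hQ aL.
move=> /(adapted_comp (fun z => (z.1.1, if z.2 then f :: z.1.2 else z.1.2))).
apply: adaptedS => i [[Ji|[g gL <-]]|->]; [by left|right|right].
  by exists g => //=; rewrite inE (gL : g \in L) orbT.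
by exists f => //=; rewrite inE eqxx.
Qed.

(** The reservoir is random but contained in the fixed [G]: all edges of [G] are tested, and the
    outcomes for edges outside the reservoir are ignored. *)
Lemma adapted_resample S (X : T -> S) (sigma : S -> fleet_state R VL VR)
    (G : {fset VL * VR}) t j :
  (forall w, reservoir (sigma (X w)) `<=` G)%fset -> adapted U (past t j) X ->
  adapted U (past t j.+1) (fun w => (X w, resample gamma (u w) t j (sigma (X w)))).
Proof.
move=> XG aX.
have := adapted_filter (fset_uniq G) (@keep_fresh t j) aX.
pose r (s : fleet_state R VL VR) (L : seq (VL * VR)) :=
  let S := [fset f in reservoir s | f \in L]%fset in
  FleetState (gamma * sampling_prob s) S
    ((gamma * sampling_prob s) ^- 4 * (num_butterflies S)%:R).
move=> /(adapted_comp (fun z => (z.1, r (sigma z.1) z.2))).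
move=> /(adaptedS (@past_keep _ _ _)).
suff -> : (fun w => (X w, r (sigma (X w))
    [seq f <- G | U (keep_choice t j f) w < gamma])) =
  (fun w => (X w, resample gamma (u w) t j (sigma (X w)))) by [].
apply/funext => w; congr (_, _); rewrite /r /resample.
set S1 := [fset _ in _ | _ \in _]%fset; set S2 := [fset _ in _ | _]%fset.
suff -> : S1 = S2 by [].
apply/fsetP => f; rewrite !inE/= mem_filter; case: (boolP (f \in reservoir _)) => //=.
by move=> /(fsubsetP (XG w)) ->; rewrite andbT.
Qed.

Lemma adapted_insert S (X : T -> S) (sigma : S -> fleet_state R VL VR) t j K :
  (forall w, exists2 k, (k <= K)%N & sampling_prob (sigma (X w)) = gamma ^+ k) ->
  adapted U (past t j) X ->
  adapted U (past t.+1 0) (fun w => (X w, insert e (u w) t (sigma (X w)))).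
Proof.
move=> XK aX.
have hQ w : sampling_prob (sigma (X w)) \in [seq gamma ^+ k | k <- iota 0 K.+1].
  by have [k kK ->] := XK w; apply/mapP; exists k; rewrite // mem_iota.
have := adapted_test (theta := fun s => sampling_prob (sigma s))
  hindep (@insert_fresh t j) hQ aX.
move=> /(adapted_comp (fun z => (z.1, if z.2 then
    let S := (e t |` reservoir (sigma z.1))%fset in
    FleetState (sampling_prob (sigma z.1)) S (estimate (sigma z.1) +
      sampling_prob (sigma z.1) ^- 4 * (num_butterflies_at S (e t))%:R)
  else sigma z.1))).
exact/adaptedS/past_insert.
Qed.

Lemma adapted_rounds S (X : T -> S) (sigma : S -> fleet_state R VL VR)
    (G : {fset VL * VR}) t n :
  (forall w, reservoir (sigma (X w)) `<=` G)%fset -> adapted U (past t 0) X ->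
  adapted U (past t n) (fun w => (X w, capped_rounds M gamma (u w) t n (sigma (X w)))).
Proof.
move=> XG aX; elim: n => [|n IH]; first exact: (adapted_comp (fun s => (s, sigma s))).
have sub w : (reservoir (capped_rounds M gamma (u w) t n (sigma (X w))) `<=` G)%fset.
  exact: fsubset_trans (capped_rounds_subset _ _ _ _ _ _) (XG w).
move: (adapted_resample (sigma := snd) (X := fun w =>
  (X w, capped_rounds M gamma (u w) t n (sigma (X w)))) sub IH) => aZ.
have := (adapted_comp (fun z =>
    (z.1.1, if (#|` reservoir z.1.2|%fset < M)%N then z.1.2 else z.2)) aZ).
exact.
Qed.

Lemma adapted_capped n t : adapted U (past t 0) (fun w => capped M gamma e (u w) n t).
Proof.
elim: t => [|t IH] /=; first exact: adapted_cst.
have aY := adapted_rounds n (sigma := fst) (fun w => capped_subset M gamma e (u w) n t) IH.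
have pY w : exists2 k, (k <= n + n * t)%N & sampling_prob
    (capped_rounds M gamma (u w) t n (capped M gamma e (u w) n t).1) = gamma ^+ k.
  have [k kn ->] := capped_rounds_prob M gamma (u w) t n (capped M gamma e (u w) n t).1.
  have [l ln ->] := capped_prob M gamma e (u w) n t.
  by exists (k + l)%N; [exact: leq_add|rewrite exprD].
move: (adapted_insert (sigma := snd) (X := fun w => (capped M gamma e (u w) n t,
  capped_rounds M gamma (u w) t n (capped M gamma e (u w) n t).1)) pY aY) => aZ.
have := adapted_comp (fun z =>
  (z.2, z.1.1.2 && (#|` reservoir z.1.2|%fset < M)%N)) aZ.
exact.
Qed.

(** The edges of [B] all pass with probability gamma^|B|, independently of [X], which cancels the
    factor gamma^-|B| gained by the weight. The factor [c] allows restriction to an event decided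
    before the round. *)
Lemma weight_resample_mean S (X : T -> S) (sigma : S -> fleet_state R VL VR)
    (c : S -> R) B t j :
  (forall w, 0 < sampling_prob (sigma (X w))) -> (forall s, 0 <= c s) ->
  adapted U (past t j) X ->
  (\int[P]_w (weight B (resample gamma (u w) t j (sigma (X w))) * c (X w))%:E =
   \int[P]_w (weight B (sigma (X w)) * c (X w))%:E)%E.
Proof.
move=> X0 c0 aX; pose f s := weight B (sigma s) * c s.
have f0 w : 0 <= f (X w) by rewrite mulr_ge0// weight_ge0.
have [mf _ hf] := adapted_ge0 aX f0.
(* [box U K C] will be the event that every edge of [B] passes its test in this round. *)
pose K := [fset keep_choice t j g | g in B]%fset.
pose C := fun _ : choice_index VL VR => `]-oo, gamma[%classic.
have mC i : measurable (C i) by exact: measurable_itv.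
have step w : weight B (resample gamma (u w) t j (sigma (X w))) * c (X w) =
    gamma ^- #|` B|%fset * (f (X w) * \1_(box U K C) w).
  rewrite weight_resample /f indicE -!mulrA; congr (_ * (_ * (_ * _))).
  rewrite mulrC; congr (_ * (nat_of_bool _)%:R); apply/forallP/idP => [h|].
    rewrite inE => i /= /imfsetP[g gB ->]; rewrite /C/= in_itv/=.
    exact: (h [` gB]%fset).
  rewrite inE => h g; have := h (keep_choice t j (val g)).
  by rewrite /C/= in_itv/=; apply; apply/imfsetP; exists (val g) => //; exact: fsvalP.
have gB0 : 0 < gamma ^+ #|` B|%fset by rewrite exprn_gt0.
have PK : P (box U K C) = (gamma ^+ #|` B|%fset)%:E.
  rewrite prob_box// (eq_bigr (fun=> gamma%:E)); last first.
    by move=> i _; rewrite prob_below// ltW//= ltW.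
  have <- : #|` K|%fset = #|` B|%fset by apply: card_imfset => g h [].
  rewrite -[in RHS](size_tuple (in_tuple K)) /=.
  elim: (enum_fset K) => [|i s IH]; first by rewrite big_nil.
  by rewrite big_cons IH /= exprS EFinM.
under eq_integral do rewrite step EFinM.
have mf1 : measurable_fun setT (fun w => f (X w) * \1_(box U K C) w).
  by apply: measurable_funM => //; apply: measurable_indic; exact: measurable_box.
rewrite ge0_integralZl_EFin//; last 3 first.
- by move=> w _; rewrite lee_fin mulr_ge0.
- exact/measurable_EFinP.
- by rewrite invr_ge0 ltW.
rewrite integral_mul_indic setTI hf//; last first.
  by move=> i /imfsetP[g _ ->]; exact: keep_fresh.
by rewrite PK muleCA -EFinM mulVf ?mule1// gt_eqF.
Qed.

(** Induction on the rounds: where the loop has stopped nothing changes, and elsewhere one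
    resampling preserves the mean. *)
Lemma weight_rounds_mean S (X : T -> S) (sigma : S -> fleet_state R VL VR)
    (G : {fset VL * VR}) (c : S -> R) B t n :
  (forall w, reservoir (sigma (X w)) `<=` G)%fset ->
  (forall w, 0 < sampling_prob (sigma (X w))) -> (forall s, 0 <= c s) ->
  adapted U (past t 0) X ->
  (\int[P]_w (weight B (capped_rounds M gamma (u w) t n (sigma (X w))) * c (X w))%:E =
   \int[P]_w (weight B (sigma (X w)) * c (X w))%:E)%E.
Proof.
move=> XG X0 c0 aX; elim: n => //= n <-.
have aY := adapted_rounds n XG aX.
set Y := fun w => (X w, _) in aY.
pose stop (s : S * fleet_state R VL VR) : R := (#|` reservoir s.2|%fset < M)%N%:R.
pose go (s : S * fleet_state R VL VR) : R := (M <= #|` reservoir s.2|%fset)%N%:R.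
have Y0 w : 0 < sampling_prob (Y w).2.
  have [k _ /= ->] := capped_rounds_prob M gamma (u w) t n (sigma (X w)).
  by rewrite mulr_gt0// exprn_gt0.
have sub w : (reservoir (Y w).2 `<=` G)%fset.
  exact: fsubset_trans (capped_rounds_subset _ _ _ _ _ _) (XG w).
have aZ := adapted_resample (sigma := snd) sub aY.
have m1 := adapted_ge0 (phi := fun z => weight B z.2 * (c z.1.1 * go z.1)) aZ.
have m2 := adapted_ge0 (phi := fun z => weight B z.2 * (c z.1 * stop z)) aY.
have m3 := adapted_ge0 (phi := fun z => weight B z.2 * (c z.1 * go z)) aY.
have r0 w : 0 < sampling_prob (resample gamma (u w) t n (Y w).2).
  exact: mulr_gt0 gamma0 (Y0 w).
have {}m1 := m1 (fun w => mulr_ge0 (weight_ge0 B (r0 w)) (mulr_ge0 (c0 _) (ler0n _ _))).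
have {}m2 := m2 (fun w => mulr_ge0 (weight_ge0 B (Y0 w)) (mulr_ge0 (c0 _) (ler0n _ _))).
have {}m3 := m3 (fun w => mulr_ge0 (weight_ge0 B (Y0 w)) (mulr_ge0 (c0 _) (ler0n _ _))).
transitivity (\int[P]_w (weight B (resample gamma (u w) t n (Y w).2) *
    (c (Y w).1 * go (Y w)) + weight B (Y w).2 * (c (Y w).1 * stop (Y w)))%:E)%E.
  apply: eq_integral => w _; rewrite /go /stop; congr (_%:E) => /=.
  by case: ltnP => _; rewrite ?(mulr0, mulr1, addr0, add0r).
rewrite (indep_off_integralD m1 m2).
(* [go] is decided before the round, so it can be absorbed into the factor [c]. *)
rewrite (weight_resample_mean (sigma := snd) (c := fun s => c s.1 * go s) B Y0 _ aY).
  rewrite -(indep_off_integralD m3 m2); apply: eq_integral => w _; congr (_%:E).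
  rewrite /go /stop /=.
  by case: ltnP => _; rewrite ?(mulr0, mulr1, addr0, add0r).
by move=> s; rewrite mulr_ge0.
Qed.

(** If [e t] lies in [B], the gain 1 / p is offset by the success probability p; otherwise the
    weight is unchanged. Cutting [B] down to the arrived edges covers both cases with one fixed
    [B]. *)
Lemma weight_insert_mean S (X : T -> S) (sigma : S -> fleet_state R VL VR)
    (c : S -> R) B t j K :
  (forall w, exists2 k, (k <= K)%N & sampling_prob (sigma (X w)) = gamma ^+ k) ->
  (forall w, e t \notin reservoir (sigma (X w))) -> (forall s, 0 <= c s) ->
  adapted U (past t j) X -> e t \notin stream_graph e t ->
  (\int[P]_w (weight (B `&` stream_graph e t.+1)%fset
      (insert e (u w) t (sigma (X w))) * c (X w))%:E =
   \int[P]_w (weight (B `&` stream_graph e t)%fset (sigma (X w)) * c (X w))%:E)%E.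
Proof.
move=> XK eX c0 aX et; rewrite stream_graphS fsetIUr.
have etB : e t \notin (B `&` stream_graph e t)%fset by rewrite inE (negbTE et) andbF.
have X0 w : 0 < sampling_prob (sigma (X w)).
  by have [k _ ->] := XK w; rewrite exprn_gt0.
have [eB|eB] := boolP (e t \in B); last first.
  apply: eq_integral => w _; congr ((_ * _)%:E).
  rewrite (_ : (B `&` [fset e t])%fset = fset0) ?fset0U ?weight_insert_notin//.
  by apply/eqP; rewrite fsetI_eq0 fdisjointX1.
rewrite (_ : (B `&` [fset e t])%fset = [fset e t]%fset); last first.
  by apply/fsetIidPr; rewrite fsub1set.
set B' := (B `&` _)%fset in etB *.
pose p s := sampling_prob (sigma s).
transitivity (\int[P]_w ((p (X w))^-1 * weight B' (sigma (X w)) * c (X w) *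
    (U (insert_choice VL VR t) w < p (X w))%R%:R)%:E)%E.
  by apply: eq_integral => w _; rewrite weight_insert_in// mulrAC.
pose Q := [seq gamma ^+ k | k <- iota 0 K.+1].
rewrite (integral_test (Q := Q) (theta := p)
  (g := fun s => (p s)^-1 * weight B' (sigma s) * c s) (@insert_fresh t j) aX).
- apply: eq_integral => w _; congr (_%:E).
  by rewrite mulrC !mulrA divff ?mul1r//; exact/lt0r_neq0/X0.
- by move=> w; rewrite /p mulr_ge0// mulr_ge0 ?weight_ge0 ?invr_ge0 ?ltW ?X0.
- by move=> w; have [k kK E] := XK w; apply/mapP; exists k; rewrite // mem_iota.
- move=> q /mapP[k _ ->]; apply/andP.
  by split; [apply: exprn_ge0|apply: exprn_ile1]; apply: ltW.
Qed.

(** * Mean weights along a stream of distinct edges, and the loss due to the cap *)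

Variable N : nat.
Hypothesis inj_e :
  forall i j : nat, (i < N)%N -> (j < N)%N -> e i = e j -> i = j.

Lemma stream_fresh t : (t < N)%N -> e t \notin stream_graph e t.
Proof.
move=> tN; apply/negP => /in_stream_graph[i it /(inj_e tN (ltn_trans it tN)) ti].
by rewrite ti ltnn in it.
Qed.

(** The state between the capped loop of arrival [t] and its insertion, with the flag as it was
    before that loop. *)
Let Y n t w : fleet_state R VL VR * bool :=
  let X := capped M gamma e (u w) n t in (capped_rounds M gamma (u w) t n X.1, X.2).

Let Ysub n t w : (reservoir (Y n t w).1 `<=` stream_graph e t)%fset.
Proof. exact: fsubset_trans (capped_rounds_subset _ _ _ _ _ _) (capped_subset _ _ _ _ _ _). Qed.

Let Yprob n t w :
  exists2 k, (k <= n + n * t)%N & sampling_prob (Y n t w).1 = gamma ^+ k.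
Proof.
have [k kn ->] := capped_rounds_prob M gamma (u w) t n (capped M gamma e (u w) n t).1.
have [l ln ->] := capped_prob M gamma e (u w) n t.
by exists (k + l)%N; [exact: leq_add|rewrite exprD].
Qed.

Let capped_prob_gt0 n t w : 0 < sampling_prob (capped M gamma e (u w) n t).1.
Proof. by have [k _ ->] := capped_prob M gamma e (u w) n t; rewrite exprn_gt0. Qed.

Let Yprob_gt0 n t w : 0 < sampling_prob (Y n t w).1.
Proof. by have [k _ ->] := Yprob n t w; rewrite exprn_gt0. Qed.

Let adaptedY n t : adapted U (past t n) (Y n t).
Proof.
have aX := adapted_rounds n (sigma := fst)
  (fun w => capped_subset M gamma e (u w) n t) (adapted_capped n t).
by have := adapted_comp (fun z => (z.2, z.1.2)) aX.
Qed.

(** The factor [c] may depend on all of [Y], because the new flag is computed from it. *)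
Lemma weight_capped_step n t B (c : fleet_state R VL VR * bool -> R) :
  (t < N)%N -> (forall s, 0 <= c s) ->
  (\int[P]_w (weight (B `&` stream_graph e t.+1)%fset
      (capped M gamma e (u w) n t.+1).1 * c (Y n t w))%:E =
   \int[P]_w (weight (B `&` stream_graph e t)%fset (Y n t w).1 * c (Y n t w))%:E)%E.
Proof.
move=> tN c0.
apply: (weight_insert_mean (X := Y n t) (sigma := fst) B
   (Yprob n t) _ c0 (@adaptedY n t) (stream_fresh tN)).
by move=> w; apply: contra (stream_fresh tN); exact/fsubsetP/Ysub.
Qed.

Lemma weight_capped_rounds n t B (c : bool -> R) : (forall b, 0 <= c b) ->
  (\int[P]_w (weight B (Y n t w).1 * c (Y n t w).2)%:E =
   \int[P]_w (weight B (capped M gamma e (u w) n t).1 *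
              c (capped M gamma e (u w) n t).2)%:E)%E.
Proof.
move=> c0; apply: (weight_rounds_mean (sigma := fst)
  (X := fun w => capped M gamma e (u w) n t) (c := fun s => c s.2)
  B n (fun w => capped_subset M gamma e (u w) n t) _ _ (adapted_capped n t)).
- exact: capped_prob_gt0.
- by [].
Qed.

Lemma weight_capped_mean n t B : (t <= N)%N ->
  (\int[P]_w (weight (B `&` stream_graph e t)%fset
      (capped M gamma e (u w) n t).1)%:E = 1)%E.
Proof.
elim: t => [_|t IH tN].
  have e0 : stream_graph e 0 = fset0.
    by apply/fsetP => f; rewrite inE; apply/in_stream_graph => -[].
  under eq_integral do rewrite e0 fsetI0 /weight cardfs0 fsub0set expr0 invr1 mulr1.
  by rewrite /= (integral_cst P measurableT 1%E) mul1e; exact: probability_setT.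
transitivity (\int[P]_w (weight (B `&` stream_graph e t.+1)%fset
   (capped M gamma e (u w) n t.+1).1 * cst 1 (Y n t w))%:E)%E.
  by apply: eq_integral => w _; rewrite mulr1.
rewrite weight_capped_step//.
rewrite (weight_capped_rounds _ _ _ (c := cst 1))//.
rewrite -(IH (ltnW tN)).
by apply: eq_integral => w _; rewrite mulr1.
Qed.

(* A loop still running holds an edge f outside B since #|B| <= 4 < M, and the
   factor gamma ^+ n comes from the extra factor 1 / p in the weight of f |` B. *)
Lemma weight_running_le n t B w : (4 < M)%N -> (#|` B|%fset <= 4)%N ->
  (B `<=` stream_graph e t)%fset ->
  weight B (Y n t w).1 * (M <= #|` reservoir (Y n t w).1|%fset)%N%:R <=
  \sum_(f <- (stream_graph e t `\` B)%fset)
    gamma ^+ n * weight (f |` B)%fset (Y n t w).1.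
Proof.
move=> hM cB BG; have p0 := Yprob_gt0 n t w.
have s0 : 0 <= \sum_(f <- (stream_graph e t `\` B)%fset)
    gamma ^+ n * weight (f |` B)%fset (Y n t w).1.
  by apply: sumr_ge0 => f _; rewrite mulr_ge0 ?weight_ge0// exprn_ge0 ?ltW.
have [MS|_] := leqP M; last by rewrite mulr0.
have [BS|BS] := boolP (B `<=` reservoir (Y n t w).1)%fset; last first.
  by rewrite /weight (negbTE BS) mulr0 mul0r.
have [f] : exists f, f \in (reservoir (Y n t w).1 `\` B)%fset.
  apply/fset0Pn; rewrite -cardfs_gt0 cardfsDS// subn_gt0.
  exact: leq_ltn_trans cB (leq_trans hM MS).
rewrite inE => /andP[fB fS].
have fG : f \in (stream_graph e t `\` B)%fset.
  by rewrite inE fB (fsubsetP (Ysub n t w)).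
rewrite (big_fsetD1 f)//= mulr1; apply: ler_wpDr.
  by apply: sumr_ge0 => g _; rewrite mulr_ge0 ?weight_ge0// exprn_ge0 ?ltW.
have [_ pE _] := capped_rounds_running MS.
have [k _ pk] := capped_prob M gamma e (u w) n t.
(* The loop starts from a power of gamma, hence at most 1, and multiplies it by gamma in each of its
   [n] rounds. *)
have p1 : sampling_prob (Y n t w).1 <= gamma ^+ n.
  by rewrite pE pk ler_piMr ?exprn_ge0 ?exprn_ile1// ltW.
rewrite /weight cardfsU1 fB add1n exprS invfM.
rewrite (_ : (f |` B `<=` _)%fset = true) ?BS ?mulr1; last first.
  by rewrite fsubUset fsub1set fS BS.
by rewrite mulrA ler_peMl ?invr_ge0 ?exprn_ge0 ?(ltW p0)// ler_pdivlMr// mul1r.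
Qed.

(** In the bound of [weight_running_le] each enlarged set has a weight of mean 1, and at most [t]
    edges [f] are added. *)
Lemma weight_running_mean n t B : (4 < M)%N -> (#|` B|%fset <= 4)%N ->
  (B `<=` stream_graph e t)%fset -> (t <= N)%N ->
  (\int[P]_w (weight B (Y n t w).1 *
     (M <= #|` reservoir (Y n t w).1|%fset)%N%:R)%:E <= (gamma ^+ n * t%:R)%:E)%E.
Proof.
move=> hM cB BG tN.
have gn0 : 0 <= gamma ^+ n by rewrite exprn_ge0// ltW.
have mY C : indep_off U (past t n) (fun w => weight C (Y n t w).1).
  by apply: (adapted_ge0 (phi := fun s => weight C s.1) (@adaptedY n t)) => w;
    exact: weight_ge0.
have mL : indep_off U (past t n) (fun w => weight B (Y n t w).1 *
     (M <= #|` reservoir (Y n t w).1|%fset)%N%:R).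
  apply: (adapted_ge0 (phi := fun s => weight B s.1 *
    (M <= #|` reservoir s.1|%fset)%N%:R) (@adaptedY n t)) => w.
  by rewrite mulr_ge0// weight_ge0.
apply: (@le_trans _ _ (\int[P]_w (\sum_(f <- (stream_graph e t `\` B)%fset)
    (gamma ^+ n)%:E * (weight (f |` B)%fset (Y n t w).1)%:E))%E).
  apply: ge0_le_integral => //.
  - by case: mL => _ mL0 _ w _; rewrite lee_fin mL0.
  - by case: mL => mL _ _; exact/measurable_EFinP.
  - apply: emeasurable_sum => f; apply: measurable_funeM.
    by case: (mY (f |` B)%fset) => m _ _; exact/measurable_EFinP.
  - move=> w _; under eq_bigr do rewrite -EFinM; rewrite sumEFin lee_fin.
    exact: weight_running_le.
have mY' f : measurable_fun setT (fun w => (weight (f |` B)%fset (Y n t w).1)%:E).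
  by case: (mY (f |` B)%fset) => m _ _; exact/measurable_EFinP.
rewrite ge0_integral_sum//; last 2 first.
- by move=> f; apply: measurable_funeM.
- by move=> f w _; rewrite mule_ge0 ?lee_fin ?weight_ge0.
rewrite (eq_big_seq (fun=> (gamma ^+ n)%:E)); last first.
  move=> f; rewrite inE => /andP[_ fG].
  rewrite ge0_integralZl_EFin//; last by move=> w _; rewrite lee_fin weight_ge0.
  have fBE : ((f |` B) `&` stream_graph e t = f |` B)%fset.
    by apply/fsetIidPl; rewrite fsubUset fsub1set fG.
  rewrite -[RHS]mule1; congr (_ * _)%E.
  rewrite -(weight_capped_mean n (f |` B)%fset tN) fBE.
  transitivity (\int[P]_w (weight (f |` B)%fset (Y n t w).1 * cst 1 (Y n t w).2)%:E)%E.
    by apply: eq_integral => w _; rewrite mulr1.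
  rewrite (weight_capped_rounds _ _ _ (c := cst 1))//.
  by apply: eq_integral => w _; rewrite mulr1.
rewrite sumEFin lee_fin big_const_seq count_predT iter_addr addr0.
rewrite -[leLHS]mulr_natr ler_wpM2l// ler_nat (leq_trans _ (card_stream_graph e t))//.
exact/fsubset_leq_card/fsubsetDl.
Qed.

(** Either the flag was lost at an earlier arrival, which is the induction hypothesis, or the
    current loop is cut, which costs at most [gamma ^+ n * t%:R]. *)
Lemma weight_capped_bad n t B : (4 < M)%N -> (#|` B|%fset <= 4)%N -> (t <= N)%N ->
  (\int[P]_w (weight (B `&` stream_graph e t)%fset (capped M gamma e (u w) n t).1 *
     (~~ (capped M gamma e (u w) n t).2)%:R)%:E <= (gamma ^+ n * (t * t)%:R)%:E)%E.
Proof.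
move=> hM cB; elim: t => [_|t IH tN].
  rewrite integral0_eq ?mulr0// => w _; by rewrite /= mulr0.
set Bt := (B `&` stream_graph e t)%fset.
have cBt : (#|` Bt|%fset <= 4)%N.
  by apply: leq_trans cB; exact/fsubset_leq_card/fsubsetIl.
pose run (s : fleet_state R VL VR * bool) : R := (M <= #|` reservoir s.1|%fset)%N%:R.
pose bad b : R := (~~ b)%:R.
(* The negation of the new flag, written as a function of [Y n t w]. *)
pose lost s := bad s.2 + (s.2)%:R * run s.
have lost0 s : 0 <= lost s by rewrite addr_ge0// mulr_ge0.
have -> : (\int[P]_w (weight (B `&` stream_graph e t.+1)%fset
      (capped M gamma e (u w) n t.+1).1 * (~~ (capped M gamma e (u w) n t.+1).2)%:R)%:E =
    \int[P]_w (weight (B `&` stream_graph e t.+1)%fset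
      (capped M gamma e (u w) n t.+1).1 * lost (Y n t w))%:E)%E.
  apply: eq_integral => w _; congr ((_ * _)%:E).
  rewrite /lost /bad /run /= negb_and -leqNgt.
  by case: (capped _ _ _ _ _ _).2; rewrite /= ?mul0r ?addr0// mul1r add0r.
rewrite weight_capped_step//.
have mY (phi : fleet_state R VL VR * bool -> R) : (forall s, 0 <= phi s) ->
    indep_off U (past t n) (fun w => weight Bt (Y n t w).1 * phi (Y n t w)).
  move=> phi0; apply: (adapted_ge0 (phi := fun s => weight Bt s.1 * phi s) (@adaptedY n t)) => w.
  by rewrite mulr_ge0// weight_ge0.
have mbad := mY (fun s => bad s.2) (fun s => ler0n _ _).
have mrun := mY run (fun s => ler0n _ _).
apply: (@le_trans _ _ (\int[P]_w (weight Bt (Y n t w).1 * bad (Y n t w).2 +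
    weight Bt (Y n t w).1 * run (Y n t w))%:E)%E).
  have := mY lost lost0; rewrite -/Bt => -[ml ml0 _].
  have [mb mb0 _] := mbad; have [mr mr0 _] := mrun.
  apply: ge0_le_integral => //.
  - by move=> w _; rewrite lee_fin ml0.
  - exact/measurable_EFinP.
  - by apply/measurable_EFinP; apply: measurable_funD.
  - move=> w _; rewrite lee_fin -mulrDr ler_wpM2l ?weight_ge0//.
    by rewrite /lost lerD2l /run ler_piMl// lern1 leq_b1.
rewrite (indep_off_integralD mbad mrun).
rewrite (weight_capped_rounds _ _ _ (c := bad))//.
apply: le_trans (leeD (IH (ltnW tN)) (weight_running_mean n hM cBt _ (ltnW tN))) _.
  exact: fsubsetIr.
rewrite -EFinD lee_fin -mulrDr; apply: ler_wpM2l; first exact/exprn_ge0/ltW.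
(* The two bounds add up to [t * t + t], which is at most [t.+1 * t.+1]. *)
by rewrite -natrD ler_nat addnC -mulnS leq_mul2r leqnSn orbT.
Qed.

End ExpectedWeight.

(** * Removing the cap *)

Lemma cvg_subr_expr (R : realType) (gamma a c : R) : 0 < gamma -> gamma < 1 ->
  (a - gamma ^+ n * c)%:E @[n --> \oo] --> a%:E.
Proof.
move=> g0 g1; apply: cvg_EFin; first by near=> n.
rewrite -[X in _ --> X]subr0; apply: cvgB; first exact: cvg_cst.
rewrite -[X in _ --> X](mul0r c); apply: cvgMl.
by apply: cvg_expr; rewrite gtr0_norm.
Unshelve. all: by end_near. Qed.

Section Limit.
Context {d : measure_display} {T : measurableType d} {R : realType}.
Variables (P : probability T R) (VL VR : choiceType).
Variables (e : nat -> VL * VR) (M : nat) (gamma : R).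
Variable U : choice_index VL VR -> {RV P >-> R}.
Hypotheses (hM : (4 < M)%N) (gamma0 : 0 < gamma) (gamma1 : gamma < 1).
Hypotheses (hindep : mutually_independent U) (hunif : standard_uniform U).
Variable t : nat.
Hypothesis inj_e :
  forall i j : nat, (i < t)%N -> (j < t)%N -> e i = e j -> i = j.

Let X n w := capped M gamma e (fun i => U i w) n t.
Let good n := [set w | (X n w).2].
Let G := stream_graph e t.

Let X0 n w : 0 < sampling_prob (X n w).1.
Proof. by have [k _ ->] := capped_prob M gamma e (fun i => U i w) n t; rewrite exprn_gt0. Qed.

Let measurable_X n (phi : fleet_state R VL VR * bool -> R) :
  (forall w, 0 <= phi (X n w)) -> measurable_fun setT (fun w => phi (X n w)).
Proof. by move=> phi0; have [] := adapted_ge0 (adapted_capped e M gamma hindep n t) phi0. Qed.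

Let measurable_good n : measurable (good n).
Proof.
have -> : good n = setT `&` (fun w => (X n w).2%:R : R) @^-1` [set 1].
  apply/seteqP; split => w /=; rewrite /good/=; first by move=> ->.
  by case: (X n w).2 => // -[_ /eqP]; rewrite eq_sym oner_eq0.
have mX := @measurable_X n (fun s => s.2%:R) (fun _ => ler0n _ _).
exact: (mX measurableT _ (measurable_set1 _)).
Qed.

Let nondecreasing_good : nondecreasing_seq good.
Proof.
apply/nondecreasing_seqP => n; rewrite subsetEset => w gw.
by rewrite /good/= /X cappedS.
Qed.

(** The empty edge set has weight 1, so [weight_capped_bad] applied to it bounds a probability. *)
Let prob_not_good n : (P (~` good n) <= (gamma ^+ n * (t * t)%:R)%:E)%E.
Proof.
have := weight_capped_bad gamma0 gamma1 hindep hunif inj_e n (B := fset0) hM isT (leqnn t).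
rewrite (_ : (\int[P]_w _)%E = P (~` good n))//.
rewrite -(setIT (~` good n)) -(integral_indic _ measurableT
  (measurableC (measurable_good n))).
apply: eq_integral => w _; rewrite fset0I /weight cardfs0 fsub0set expr0 invr1 !mul1r.
congr ((nat_of_bool _)%:R%:E); rewrite -/(X n w); apply/idP/idP.
  by move=> /negP b; rewrite inE.
by rewrite inE => b; apply/negP.
Qed.

(** The event that all loops of the first [t] arrivals terminate: there are finitely many, so one
    cap serves them all. *)
Let A := \bigcup_n good n.

Let conull_good : P (~` A) = 0%E.
Proof.
apply/eqP; rewrite eq_le measure_ge0 andbT.
(* With these constants the sequence is the bound of [prob_not_good], and it tends to 0. *)
have c0 := cvg_subr_expr (a := 0) (- (t * t)%:R) gamma0 gamma1.
apply: (cvge_ge _ c0); near=> n; rewrite sub0r mulrN opprK.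
apply: le_trans (prob_not_good n); apply: le_measure; rewrite ?inE.
- exact/measurableC/bigcup_measurable.
- exact: measurableC.
- by apply: subsetC; exact: bigcup_sup.
Unshelve. all: by end_near. Qed.

Let h n w := \sum_(B <- butterflies G) weight B (X n w).1.

Let butterflyI B : B \in butterflies G ->
  (#|` B|%fset <= 4)%N /\ (B `&` G = B)%fset.
Proof.
rewrite in_butterflies => /andP[BG /asboolP/card_butterfly ->]; split => //.
exact/fsetIidPl.
Qed.

Let measurable_weight n B (c : bool -> R) : (forall b, 0 <= c b) ->
  measurable_fun setT (fun w => (weight B (X n w).1 * c (X n w).2)%:E).
Proof.
move=> c0; apply/measurable_EFinP.
apply: (@measurable_X n (fun s => weight B s.1 * c s.2)) => w.
by rewrite mulr_ge0// weight_ge0.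
Qed.

Let integral_h n (c : bool -> R) : (forall b, 0 <= c b) ->
  (\int[P]_w (h n w * c (X n w).2)%:E =
   \sum_(B <- butterflies G) \int[P]_w (weight (B `&` G)%fset (X n w).1 * c (X n w).2)%:E)%E.
Proof.
move=> c0; under eq_integral do rewrite mulr_suml -sumEFin.
rewrite ge0_integral_sum//.
- by apply: eq_big_seq => B /butterflyI[_ ->].
- by move=> B; exact: measurable_weight.
- by move=> B w _; rewrite lee_fin mulr_ge0// weight_ge0.
Qed.

Let nb : R := (num_butterflies G)%:R.

Let sum_nb (a : R) : (\sum_(B <- butterflies G) a%:E = (a * nb)%:E)%E.
Proof.
rewrite sumEFin big_const_seq count_predT iter_addr addr0 -mulr_natr.
by [].
Qed.

Let g w := fleet1_estimate M gamma e U t w.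

Let g_ge0 w : 0 <= g w.
Proof.
rewrite /g /fleet1_estimate (estimate_fleet1 _ _ _ (leqnn t))//.
by rewrite mulr_ge0// invr_ge0 exprn_even_ge0.
Qed.

(** On [good n] the capped run is FLEET1 itself, and a butterfly has four edges, so its weight
    carries the exponent 4 of the estimate. *)
Let g_good n w : good n w -> g w = h n w.
Proof.
move=> gw; rewrite /g /fleet1_estimate (estimate_fleet1 _ _ _ (leqnn t))//.
rewrite -(capped_fleet1 gw) -/(X n w) (num_butterfliesE (G := G)); last exact: capped_subset.
rewrite natr_sum mulr_sumr; apply: eq_big_seq => B.
by rewrite in_butterflies => /andP[_ /asboolP/card_butterfly]; rewrite /weight => ->.
Qed.

Let measurable_g n : measurable_fun (good n) (EFin \o g).
Proof.
apply: (eq_measurable_fun (fun w => (h n w * cst 1 (X n w).2)%:E)).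
  by move=> w; rewrite inE => /g_good /= ->; rewrite mulr1.
apply: measurable_funTS; under eq_fun do rewrite mulr_suml -sumEFin.
by apply: emeasurable_sum => B; exact: measurable_weight.
Qed.

(** Over all runs [h n] has mean exactly [nb], each butterfly contributing 1. The integral over
    [good n] is what remains after removing the part [J] of the cut runs, which [weight_capped_bad]
    bounds. *)
Let integral_good n : ((nb - gamma ^+ n * ((t * t)%:R * nb))%:E <=
  \int[P]_(w in good n) (g w)%:E <= nb%:E)%E.
Proof.
pose J := (\int[P]_w (h n w * (~~ (X n w).2)%:R)%:E)%E.
have m (c : bool -> R) : (forall b, 0 <= c b) ->
    measurable_fun setT (fun w => (h n w * c (X n w).2)%:E).
  move=> c0; under eq_fun do rewrite mulr_suml -sumEFin.
  by apply: emeasurable_sum => B; exact: measurable_weight.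
have h0 w : 0 <= h n w by apply: sumr_ge0 => B _; rewrite weight_ge0.
have -> : (\int[P]_(w in good n) (g w)%:E = \int[P]_w (h n w * (X n w).2%:R)%:E)%E.
  rewrite integral_mkcond; apply: eq_integral => w _; rewrite patchE.
  case: ifPn => [|/negP]; rewrite inE => gw.
    by rewrite (g_good gw) gw mulr1.
  by move: gw => /negP/negbTE ->; rewrite mulr0.
have IJ : (\int[P]_w (h n w * (X n w).2%:R)%:E + J = nb%:E)%E.
  rewrite -(mul1r nb) -sum_nb -integral_addr//.
  - transitivity (\int[P]_w (h n w * cst 1 (X n w).2)%:E)%E.
      by apply: eq_integral => w _; congr EFin;
        case: (X n w).2; rewrite /= mulr1 mulr0 ?addr0 ?add0r.
    rewrite integral_h//; apply: eq_big_seq => B BG.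
    rewrite -(weight_capped_mean M gamma0 gamma1 hindep hunif inj_e n B (leqnn t)).
    by apply: eq_integral => w _; rewrite mulr1.
  - by apply/measurable_EFinP; exact: (m (fun b => b%:R)).
  - by move=> w; rewrite mulr_ge0.
  - by apply/measurable_EFinP; exact: (m (fun b => (~~ b)%:R)).
  - by move=> w; rewrite mulr_ge0.
have J0 : (0 <= J)%E by apply: integral_ge0 => w _; rewrite lee_fin mulr_ge0.
have Jle : (J <= (gamma ^+ n * ((t * t)%:R * nb))%:E)%E.
  rewrite mulrA -sum_nb /J (integral_h n (c := fun b => (~~ b)%:R))// big_seq [leRHS]big_seq.
  apply: lee_sum => B /butterflyI[cB _].
  exact: (weight_capped_bad gamma0 gamma1 hindep hunif inj_e n hM cB (leqnn t)).
have I0 : (0 <= \int[P]_w (h n w * (X n w).2%:R)%:E)%E.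
  by apply: integral_ge0 => w _; rewrite lee_fin mulr_ge0.
move: I0 J0 Jle IJ; set I := (\int[P]_w _)%E.
(* Both parts are nonnegative and their sum is finite, so both are finite. *)
case: I => [r| |]; case: J => [s| |]//=; rewrite -?EFinD ?lee_fin.
move=> r0 s0 sle [rs]; apply/andP; split; last by rewrite -rs lerDl.
by rewrite lerBlDr -[leLHS]rs lerD2l.
Qed.

(** The integral reduces to the conull event [A], where measurability is available. The integrals
    over the increasing [good n] tend to the one over [A] by monotone convergence, and to [nb] by
    squeezing. *)
Lemma fleet1_mean : (\int[P]_w (fleet1_estimate M gamma e U t w)%:E =
  (num_butterflies (stream_graph e t))%:R%:E)%E.
Proof.
rewrite (ge0_integral_conull (A := A) _ conull_good); last 3 first.
- exact: bigcup_measurable.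
- by apply/measurable_fun_bigcup.
- by move=> w; rewrite lee_fin g_ge0.
have lim1 : (\int[P]_(w in good n) (g w)%:E @[n --> \oo] --> \int[P]_(w in A) (g w)%:E)%E.
  by apply: ge0_nondecreasing_set_cvg_integral => // n w _; rewrite lee_fin g_ge0.
have lim2 : (\int[P]_(w in good n) (g w)%:E @[n --> \oo] --> nb%:E)%E.
  apply: squeeze_cvge; last 2 first.
  - exact: (cvg_subr_expr (a := nb) ((t * t)%:R * nb) gamma0 gamma1).
  - exact: cvg_cst.
  exact: nearW integral_good.
exact: (cvg_unique _ lim1 lim2).
Qed.

End Limit.

(* 4 < M: a reservoir of at most 4 edges contains no butterfly after any
   resampling (the loop stops below M edges), so the claim fails for M <= 4. *)
Theorem lemma2 (d : measure_display) (T : measurableType d) (R : realType)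
    (P : probability T R) (VL VR : choiceType)
    (e : nat -> VL * VR) (M : nat) (gamma : R)
    (U : choice_index VL VR -> {RV P >-> R}) (t : nat)
    (hM : (4 < M)%N) (hgamma0 : 0 < gamma) (hgamma1 : gamma < 1)
    (hindep : mutually_independent U) (hunif : standard_uniform U)
    (ht : (1 <= t)%N)
    (hdistinct : forall i j : nat, (i < t)%N -> (j < t)%N -> e i = e j -> i = j) :
  ('E_P[fleet1_estimate M gamma e U t] =
   (num_butterflies (stream_graph e t))%:R%:E)%E.
Proof. by rewrite unlock; exact: fleet1_mean. Qed.
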